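(* Consider the planar system $$\dot x=-x-y,\qquad \dot y=px+ry-sy^2-y^3$$ and its equilibrium $P_1=(x_1^*,-x_1^* )$, where $x_1^*=\tfrac12\big(s+\sqrt{s^2+4(r-p)}\big)$. The equilibrium $P_1$ undergoes a subcritical Hopf bifurcation when $$s\ge0,\qquad p>1,\qquad r=\tfrac18\Big(-4+12p-s^2-s\sqrt{-8+8p+s^2}\Big).$$
   Context: The parameters $p,r$ are positive reals and $s\ge 0$; $r$ is the bifurcation parameter. A Hopf bifurcation at an equilibrium means that the Jacobian has a pair of purely imaginary eigenvalues $\pm i\omega$, $\omega>0$, at the critical parameter value, crossing the imaginary axis transversally as the parameter varies. It is subcritical if the first Lyapunov coefficient $l_1$ at the equilibrium is positive (the bifurcating limit cycle is unstable). Here $l_1=\frac1{2\omega^2}\operatorname{Re}(ig_{20}g_{11}+\omega g_{21})$, where, after translating the equilibrium to the origin and writing the state as $z\mathbf q+\bar z\bar{\mathbf q}$ with $\mathbf q$ an eigenvector for $i\omega$, the system takes the form $\dot z=i\omega z+\sum_{j+k\ge2}\frac{1}{j!k!}g_{jk}z^j\bar z^k$ (the sign of $l_1$ does not depend on the choice of $\mathbf q$). *)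

(* Defs.v *)
From mathcomp Require Export all_boot all_order all_algebra complex.
From mathcomp Require Export all_classical all_reals all_analysis.
Export Order.TTheory GRing.Theory Num.Theory.
Export numFieldNormedType.Exports.

Set Implicit Arguments.
Unset Strict Implicit.
Unset Printing Implicit Defensive.

Local Open Scope classical_set_scope.
Local Open Scope ring_scope.
Local Open Scope complex_scope.

(* Vectors are rows and ['J f a] acts on them from the right, so the (right)
   eigenvectors of the usual Jacobian are the q with q *m 'J f a = lambda *: q,
   which is the convention of [eigenvalue] and [eigenspace]. *)

Definition complex_jacobian (R : realType) (f : 'rV[R]_2 -> 'rV[R]_2)
    (a : 'rV[R]_2) : 'M[R[i]]_2 :=
  map_mx (fun t : R => t%:C) ('J f a).

(* f mu is the vector field at parameter value mu, and e mu its equilibrium.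
   The critical pair of eigenvalues is continued to a differentiable pair
   lambda mu, (lambda mu)^*, whose real part has nonzero derivative at mu0. *)
Definition hopf_bifurcation (R : realType) (f : R -> 'rV[R]_2 -> 'rV[R]_2)
    (e : R -> 'rV[R]_2) (mu0 omega : R) : Prop :=
  [/\ \forall mu \near mu0, f mu (e mu) = 0 /\ differentiable (f mu) (e mu),
      derivable e mu0 1,
      0 < omega
    & exists lambda : R -> R[i],
      [/\ \forall mu \near mu0,
            eigenvalue (complex_jacobian (f mu) (e mu)) (lambda mu) /\
            eigenvalue (complex_jacobian (f mu) (e mu)) (lambda mu)^*,
          lambda mu0 = 0 +i* omega,
          derivable (fun mu => complex.Re (lambda mu)) mu0 1,
          derivable (fun mu => complex.Im (lambda mu)) mu0 1
        & 'D_1 (fun mu => complex.Re (lambda mu)) mu0 != 0]].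

(* z q + \bar z \bar q, whose entries are real. *)
Definition real_state (R : realType) (q : 'rV[R[i]]_2) (z : R[i]) : 'rV[R]_2 :=
  map_mx (@complex.Re R) (z *: q + z^* *: map_mx conjc q).

(* In the coordinate z, the system translated from a to the origin reads
   \dot z = G z. *)
Definition complex_form (R : realType) (f : 'rV[R]_2 -> 'rV[R]_2)
    (a : 'rV[R]_2) (q : 'rV[R[i]]_2) (G : R[i] -> R[i]) : Prop :=
  forall z, f (a + real_state q z) = real_state q (G z).

(* G z = i omega z + \sum_(j + k >= 2) g j k / (j! k!) z^j \bar z^k as a Taylor
   series at 0: every truncation at total degree N has an error O(|z|^(N+1)). *)
Definition taylor_coefficients (R : realType) (G : R[i] -> R[i]) (omega : R)
    (g : nat -> nat -> R[i]) : Prop :=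
  forall N : nat, exists C delta : R, 0 < delta /\
    forall z : R[i], Normc.normc z < delta ->
      Normc.normc (G z - (0 +i* omega) * z -
        \sum_(j < N.+1) \sum_(k < N.+1 | (2 <= j + k <= N)%N)
          g j k / (j`! * k`!)%:R * z ^+ j * z^* ^+ k)
      <= C * Normc.normc z ^+ N.+1.

Definition lyapunov1 (R : realType) (omega : R) (g : nat -> nat -> R[i]) : R :=
  (2 * omega ^+ 2)^-1 *
  complex.Re ((0 +i* 1) * g 2%N 0%N * g 1%N 1%N + omega%:C * g 2%N 1%N).

(* The sign of the first Lyapunov coefficient does not depend on the choice of
   the eigenvector q, so its positivity is required for every q. *)
Definition subcritical_hopf_bifurcation (R : realType)
    (f : R -> 'rV[R]_2 -> 'rV[R]_2) (e : R -> 'rV[R]_2) (mu0 : R) : Prop :=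
  exists omega : R, hopf_bifurcation f e mu0 omega /\
    forall q : 'rV[R[i]]_2, q != 0 ->
      q *m complex_jacobian (f mu0) (e mu0) = (0 +i* omega) *: q ->
      exists G g, [/\ complex_form (f mu0) (e mu0) q G,
                      taylor_coefficients G omega g
                    & 0 < lyapunov1 omega g].

Definition vec2 (R : realType) (x y : R) : 'rV[R]_2 :=
  \row_(j < 2) if j == 0 then x else y.

Definition planar_field (R : realType) (p s r : R) (X : 'rV[R]_2) : 'rV[R]_2 :=
  let x := X 0 0 in let y := X 0 1 in
  vec2 (- x - y) (p * x + r * y - s * y ^+ 2 - y ^+ 3).

Definition x1star (R : realType) (p s r : R) : R :=
  2^-1 * (s + Num.sqrt (s ^+ 2 + 4 * (r - p))).

Definition P1 (R : realType) (p s r : R) : 'rV[R]_2 :=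
  vec2 (x1star p s r) (- x1star p s r).

(* Main.v *)
From HB Require Import structures.
From mathcomp Require Import ring lra.
Require Import Defs.
Set Implicit Arguments.
Unset Strict Implicit.
Unset Printing Implicit Defensive.
Local Open Scope classical_set_scope.
Local Open Scope ring_scope.
Local Open Scope complex_scope.

(**
Everything is explicit.  With w = sqrt (8 p - 8 + s^2), so that 0 <= s < w, the
critical value of r gives x1* = (s + w) / 4, a discriminant
s^2 + 4 (r - p) = ((w - s) / 2)^2 > 0 and p - 1 = (w^2 - s^2) / 8
([critical_values]).

Linear part.  The Jacobian at P1 has trace T = 3 p - 1 - 2 r - s x1* and
determinant p - 1 - T.  T vanishes at the critical value, which leaves the
eigenvalues +- i omega with omega^2 = p - 1.  Since x1* increases with r, T is
strictly decreasing in r: the pair T / 2 +- i sqrt (p - 1 - T - T^2 / 4)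
crosses the imaginary axis transversally ([hopf_bifurcation_P1]).

Nonlinear part.  In coordinates (X, Y) centred at P1 the only nonlinear terms
are b Y^2 - Y^3 in the second equation, with b = 3 x1* - s.  An eigenvector
(q0, q1) satisfies q1 = - (1 + i omega) q0, and the system becomes
  z' = i omega z + c (b Y^2 - Y^3),  Y = z q1 + conj (z q1),
  c = i / (2 omega q0)
([complex_form_complexified_field]).  Hence g_jk = c phi_(j+k) q1^j conj(q1)^k,
where phi_2 = 2 b and phi_3 = - 6 are the derivatives of b Y^2 - Y^3 at 0.
As c q1 = 1/2 - i / (2 omega), this yields
  Re (i g20 g11 + omega g21) = |q1|^2 (2 b^2 - 3 omega^2) / omega
([lyapunov1_complexified_jet]).  At the critical value b = (3 w - s) / 4, so
  2 b^2 - 3 omega^2 = (6 w (w - s) + 4 s^2) / 8 > 0.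
*)

(** * Linear algebra of the Jacobian *)

Lemma vec2_0 (R : realType) (x y : R) : vec2 x y 0 0 = x.
Proof. by rewrite mxE. Qed.

Lemma vec2_1 (R : realType) (x y : R) : vec2 x y 0 1 = y.
Proof. by rewrite mxE. Qed.

Lemma rV2P (T : Type) (u v : 'rV[T]_2) :
  u 0 0 = v 0 0 -> u 0 1 = v 0 1 -> u = v.
Proof.
move=> e0 e1; apply/rowP; case=> [[|[|//]] lt_i2].
- by move: e0; congr (u _ _ = v _ _); exact: val_inj.
- by move: e1; congr (u _ _ = v _ _); exact: val_inj.
Qed.

(** The transpose of the usual Jacobian matrix, since it acts on row vectors;
    m stands for the derivative of y' with respect to y. *)
Definition jac2 (R : nzRingType) (p m : R) : 'M[R]_2 :=
  \matrix_(i, j) if j == 0 then -1 else if i == 0 then p else m.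

Lemma mul_jac2 (R : nzRingType) (p m : R) (q : 'rV[R]_2) :
  ((q *m jac2 p m) 0 0 = - q 0 0 - q 0 1) *
  ((q *m jac2 p m) 0 1 = q 0 0 * p + q 0 1 * m).
Proof.
have e1 : lift ord0 ord0 = 1 :> 'I_2 by exact: val_inj.
by split; rewrite mxE big_ord_recl big_ord1 e1 !mxE /= ?mulrN1.
Qed.

(** The vector (1, - (1 + l)) solves the first eigenvector equation for every
    l; the characteristic equation is what the second one then requires. *)
Lemma eigenvalue_jac2 (F : fieldType) (p m l : F) :
  l ^+ 2 - (m - 1) * l + (p - m) = 0 -> eigenvalue (jac2 p m) l.
Proof.
move=> char0; apply/eigenvalueP.
pose v : 'rV[F]_2 := \row_j if j == 0 then 1 else - (1 + l).
exists v.
  apply: rV2P; rewrite mul_jac2 !mxE /=; first by ring.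
  by apply/eqP; rewrite -subr_eq0 -[X in _ == X]char0; apply/eqP; ring.
by apply/eqP=> /rowP/(_ 0)/eqP; rewrite !mxE /= oner_eq0.
Qed.

Lemma eigenvector_jac2 (F : fieldType) (p m l : F) (q : 'rV[F]_2) :
  q *m jac2 p m = l *: q -> q != 0 -> q 0 0 != 0 /\ q 0 1 = - (1 + l) * q 0 0.
Proof.
move=> eigq; have /eqP := congr1 (fun u : 'rV[F]_2 => u 0 0) eigq.
rewrite mul_jac2 mxE -subr_eq0 => /eqP e0.
have e1 : q 0 1 = - (1 + l) * q 0 0.
  by apply/eqP; rewrite -subr_eq0 -oppr_eq0 -[X in _ == X]e0; apply/eqP; ring.
move=> q_neq0; split=> //; apply: contra q_neq0 => /eqP q0.
by apply/eqP/rV2P; rewrite ?e1 q0 ?mulr0 mxE.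
Qed.

(** The two roots of the characteristic polynomial when its discriminant is
    nonpositive: half the trace, plus or minus i times a real square root. *)
Lemma conjugate_eigenvalues_jac2 (R : realType) (p m : R) :
  let t := (m - 1) / 2 in t ^+ 2 <= p - m ->
  let l := t +i* Num.sqrt (p - m - t ^+ 2) in
  eigenvalue (jac2 p%:C m%:C) l /\ eigenvalue (jac2 p%:C m%:C) l^*.
Proof.
move=> t le_t; set w := Num.sqrt _ => l.
have w2 : w ^+ 2 = p - m - t ^+ 2 by rewrite sqr_sqrtr ?subr_ge0.
have m_t : m = 2 * t + 1 by rewrite /t; field.
split; apply: eigenvalue_jac2; rewrite expr2 /l; simpc;
  apply/eqP; rewrite eq_complex /=;
  apply/andP; split; apply/eqP; rewrite ?m_t; try ring;
  rewrite -!expr2 w2 m_t; ring.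
Qed.

(** * The vector field and its equilibrium *)

Lemma is_diff_coord (R : realType) m n (i : 'I_m) (j : 'I_n)
    (M : 'M[R]_(m, n)) :
  is_diff M (fun N : 'M[R]_(m, n) => N i j) (fun N : 'M[R]_(m, n) => N i j).
Proof.
pose cij (N : 'M[R]_(m, n)) : R := N i j.
have lin_cij : linear cij by move=> k u v; rewrite /cij !mxE.
pose L : {linear 'M[R]_(m, n) -> R} :=
  HB.pack cij (GRing.isLinear.Build _ _ _ _ cij lin_cij).
apply: DiffDef; first exact: differentiable_coord.
by rewrite (diff_lin (f := L)) //; exact: coord_continuous.
Qed.

Lemma is_diff_planar_field (R : realType) (p s r : R) (a : 'rV[R]_2) :
  is_diff a (planar_field p s r)
    (fun v => v *m jac2 p (r - 2 * s * a 0 1 - 3 * a 0 1 ^+ 2)).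
Proof.
pose cx (v : 'rV[R]_2) : R := v 0 0; pose cy (v : 'rV[R]_2) : R := v 0 1.
have dx : is_diff a cx cx by exact: is_diff_coord.
have dy : is_diff a cy cy by exact: is_diff_coord.
have -> : planar_field p s r =
    (fun v => (- cx - cy) v *: vec2 1 0) +
    (fun v => (p *: cx + r *: cy - s *: cy ^+ 2 - cy ^+ 3) v *: vec2 0 1).
  apply/funext=> v; apply: rV2P;
    rewrite /planar_field /= !fctE !mxE /= /cx /cy ?exprfctE;
    rewrite /GRing.scale /=.
  - ring.
  - ring.
have df0 : is_diff a (- cx - cy) (- cx - cy) by apply: is_diffB.
have dy2 := @is_diffX _ _ cy cy 1 a dy.
have dy3 := @is_diffX _ _ cy cy 2 a dy.
have df1 := is_diffB (is_diffB (is_diffD (is_diffZ p dx) (is_diffZ r dy))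
  (is_diffZ s dy2)) dy3.
have dfe0 := is_diff_comp df0 (is_diff_scalel _ (vec2 1 0 : 'rV[R]_2)).
have dfe1 := is_diff_comp df1 (is_diff_scalel _ (vec2 0 1 : 'rV[R]_2)).
have df := is_diffD dfe0 dfe1.
apply: (is_diff_eq df).
apply/funext=> v; apply: rV2P; rewrite mul_jac2 /= !fctE !mxE /= /cx /cy;
  rewrite /GRing.scale /=; ring.
Qed.

Lemma jacobian_planar_field (R : realType) (p s r : R) (a : 'rV[R]_2) :
  'J (planar_field p s r) a =
  jac2 p (r - 2 * s * a 0 1 - 3 * a 0 1 ^+ 2).
Proof.
apply/matrixP=> i j; rewrite mxE.
by rewrite (diff_val (is_diff_def := is_diff_planar_field p s r a)) -rowE mxE.
Qed.

Lemma complex_jacobian_planar_field (R : realType) (p s r : R) (a : 'rV[R]_2) :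
  complex_jacobian (planar_field p s r) a =
  jac2 p%:C (r - 2 * s * a 0 1 - 3 * a 0 1 ^+ 2)%:C.
Proof.
rewrite /complex_jacobian jacobian_planar_field.
apply/matrixP=> i j; rewrite !mxE.
by do 2?case: ifP => _ //; rewrite rmorphN1.
Qed.

(** The points (x, - x) that are equilibria are the roots of
    x (x^2 - s x - (r - p)); x1* is a root of the second factor. *)
Lemma x1star_equation (R : realType) (p s r : R) :
  0 <= s ^+ 2 + 4 * (r - p) ->
  x1star p s r ^+ 2 = s * x1star p s r + (r - p).
Proof.
move=> disc_ge0; have := sqr_sqrtr disc_ge0.
rewrite /x1star; set w := Num.sqrt _ => w2.
by rewrite exprMn sqrrD w2; field.
Qed.

Lemma planar_field_P1 (R : realType) (p s r : R) :
  0 <= s ^+ 2 + 4 * (r - p) -> planar_field p s r (P1 p s r) = 0.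
Proof.
move=> /x1star_equation x2; rewrite /planar_field /P1 vec2_0 vec2_1.
set x := x1star p s r in x2 *.
apply: rV2P; rewrite !mxE /=; first by ring.
transitivity (x * (x ^+ 2 - (s * x + (r - p)))); first by ring.
by rewrite x2 subrr mulr0.
Qed.

(** Only the second component is nonlinear, and only through y: this is why a
    single polynomial in one variable yields all the Taylor coefficients of
    degree at least 2. *)
Lemma planar_field_translate (R : realType) (p s r x : R) (X : 'rV[R]_2) :
  let a := vec2 x (- x) in
  planar_field p s r a = 0 ->
  planar_field p s r (a + X) =
    vec2 (- X 0 0 - X 0 1)
      (p * X 0 0 + (r + 2 * s * x - 3 * x ^+ 2) * X 0 1
       + (3 * x - s) * X 0 1 ^+ 2 - X 0 1 ^+ 3).
Proof.
move=> a; have a0 : a 0 0 = x by rewrite mxE.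
have a1 : a 0 1 = - x by rewrite mxE.
move=> /rowP/(_ 1); rewrite mxE /= a0 a1 !mxE => f0.
apply: rV2P; rewrite !mxE /=; first by ring.
apply/eqP; rewrite -subr_eq0 -[X in _ == X]f0; apply/eqP; ring.
Qed.

(** * Transversal crossing of the imaginary axis *)

Lemma is_derive_x1star (R : realType) (p s r : R) :
  0 < s ^+ 2 + 4 * (r - p) ->
  is_derive r 1 (x1star p s) (Num.sqrt (s ^+ 2 + 4 * (r - p)))^-1.
Proof.
move=> disc_gt0.
pose disc (mu : R) := s ^+ 2 + 4 * (mu - p).
have ddisc : is_derive r 1 disc 4.
  have -> : disc = cst (s ^+ 2 - 4 * p) + 4 *: id.
    by apply/funext=> mu; rewrite /disc !fctE /GRing.scale /=; ring.
  apply: (is_derive_eq (is_deriveD (is_derive_cst _ _ _)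
    (is_deriveZ 4 (is_derive_id _ _)))).
  by rewrite add0r /GRing.scale /= mulr1.
have dsqrt := is_derive1_comp (is_derive1_sqrt (disc_gt0 : 0 < disc r)) ddisc.
have -> : x1star p s = cst (2^-1 * s) + 2^-1 *: (Num.sqrt \o disc).
  by apply/funext=> mu; rewrite /x1star !fctE /GRing.scale /= mulrDr.
apply: (is_derive_eq (is_deriveD (is_derive_cst _ _ _)
  (is_deriveZ 2^-1 dsqrt))).
rewrite add0r /GRing.scale /=.
have sqrt_neq0 : Num.sqrt (disc r) != 0 by rewrite gt_eqF // sqrtr_gt0.
by rewrite /disc in sqrt_neq0 *; field.
Qed.

Lemma derivable_P1 (R : realType) (p s r : R) :
  derivable (x1star p s) r 1 -> derivable (P1 p s) r 1.
Proof.
move=> dx; apply/derivable_mxP => i j; rewrite /P1.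
have -> : (fun mu => vec2 (x1star p s mu) (- x1star p s mu) i j) =
    if j == 0 then x1star p s else - x1star p s.
  by apply/funext=> mu; rewrite mxE; case: ifP.
by case: ifP => _; [exact: dx | exact: derivableN dx].
Qed.

(** The trace at the equilibrium, made affine in x1* by means of
    [x1star_equation]. *)
Definition P1_trace (R : realType) (p s mu : R) : R :=
  3 * p - 1 - 2 * mu - s * x1star p s mu.

Lemma complex_jacobian_P1 (R : realType) (p s r : R) :
  0 <= s ^+ 2 + 4 * (r - p) ->
  complex_jacobian (planar_field p s r) (P1 p s r) =
  jac2 p%:C (1 + P1_trace p s r)%:C.
Proof.
move=> /x1star_equation x2; rewrite complex_jacobian_planar_field vec2_1.
by congr (jac2 _ _%:C); rewrite sqrrN x2 /P1_trace; ring.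
Qed.

(** The real part of the eigenvalue pair is T / 2, with derivative
    - (1 + s x1*' / 2) where x1*' > 0; this is negative as soon as s >= 0.
    The imaginary part stays differentiable because the radicand equals
    p - 1 > 0 at the critical value. *)
Lemma hopf_bifurcation_P1 (R : realType) (p s r : R) :
  0 <= s -> 1 < p -> 0 < s ^+ 2 + 4 * (r - p) -> P1_trace p s r = 0 ->
  hopf_bifurcation (planar_field p s) (P1 p s) r (Num.sqrt (p - 1)).
Proof.
move=> s_ge0 p_gt1 disc_gt0 tr0.
have dx := is_derive_x1star disc_gt0.
pose t mu := P1_trace p s mu / 2.
have tr : t r = 0 by rewrite /t tr0 mul0r.
pose t' := - (1 + s / (2 * Num.sqrt (s ^+ 2 + 4 * (r - p)))).
have dt : is_derive r 1 t t'.
  have -> : t = cst ((3 * p - 1) / 2) - id - (s / 2) *: x1star p s.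
    by apply/funext=> mu; rewrite /t /P1_trace !fctE /GRing.scale /=; field.
  apply: (is_derive_eq (is_deriveB (is_deriveB (is_derive_cst _ _ _)
    (is_derive_id _ _)) (is_deriveZ (s / 2) dx))).
  rewrite /GRing.scale /= /t'.
  have sqrt_neq0 : Num.sqrt (s ^+ 2 + 4 * (r - p)) != 0.
    by rewrite gt_eqF // sqrtr_gt0.
  by field.
pose rad mu := p - 1 - 2 * t mu - t mu ^+ 2.
have rad_r : rad r = p - 1 by rewrite /rad tr expr2; ring.
have rad_gt0 : 0 < rad r by rewrite rad_r subr_gt0.
have drad : derivable rad r 1.
  have -> : rad = cst (p - 1) - 2 *: t - t ^+ 2.
    by apply/funext=> mu; rewrite /rad !fctE /GRing.scale /=.
  have [dert _] := dt.
  apply: derivableB; last exact: derivableX.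
  by apply: derivableB; [exact: derivable_cst | exact: derivableZ].
have near_disc : \forall mu \near r, 0 < s ^+ 2 + 4 * (mu - p).
  have c_disc : {for r, continuous (fun mu : R => s ^+ 2 + 4 * (mu - p))}.
    apply: continuousD; first exact: cst_continuous.
    apply: continuousM; first exact: cst_continuous.
    by apply: continuousB; [exact: cvg_id | exact: cst_continuous].
  exact: (cvgr_gt _ c_disc _ disc_gt0).
have near_rad : \forall mu \near r, 0 < rad mu.
  have /derivable1_diffP/differentiable_continuous c_rad := drad.
  exact: (cvgr_gt _ c_rad _ rad_gt0).
split.
- near=> mu; split.
    by apply: planar_field_P1; apply: ltW; near: mu.
  by have [] := is_diff_planar_field p s mu (P1 p s mu).
- by apply: derivable_P1; case: dx.
- by rewrite sqrtr_gt0 subr_gt0.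
exists (fun mu => t mu +i* Num.sqrt (rad mu)); split.
- near=> mu.
  rewrite complex_jacobian_P1; last by apply: ltW; near: mu.
  have t_mu : t mu = (1 + P1_trace p s mu - 1) / 2 by rewrite /t; ring.
  have rad_mu : rad mu = p - (1 + P1_trace p s mu) - t mu ^+ 2.
    by rewrite /rad /t; field.
  rewrite rad_mu t_mu; apply: conjugate_eigenvalues_jac2.
  by rewrite -t_mu -subr_ge0 -rad_mu; apply: ltW; near: mu.
- by rewrite tr rad_r.
- by case: dt.
- have /derivableP drad' := drad.
  by have [] := is_derive1_comp (is_derive1_sqrt rad_gt0) drad'.
- have -> : 'D_1 (fun mu => complex.Re (t mu +i* Num.sqrt (rad mu))) r = t'.
    by case: dt.
  by rewrite oppr_eq0 gt_eqF // ltr_wpDr // divr_ge0 // mulr_ge0.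
Unshelve. all: by end_near. Qed.

(** * Taylor coefficients of polynomials in z and its conjugate *)

Lemma normc_ge0 (R : rcfType) (z : R[i]) : 0 <= Normc.normc z.
Proof. by case: z => a b; exact: sqrtr_ge0. Qed.

Lemma normcX (R : rcfType) (z : R[i]) n :
  Normc.normc (z ^+ n) = Normc.normc z ^+ n.
Proof.
by elim: n => [|n IHn]; [exact: Normc.normc1 | rewrite !exprS Normc.normcM IHn].
Qed.

Lemma normc_conjc (R : rcfType) (z : R[i]) :
  Normc.normc z^* = Normc.normc z.
Proof. by case: z => a b /=; rewrite sqrrN. Qed.

Lemma normc_sum_le (R : rcfType) I (r : seq I) (P : pred I) (F : I -> R[i])
    (f : I -> R) :
  (forall i, P i -> Normc.normc (F i) <= f i) ->
  Normc.normc (\sum_(i <- r | P i) F i) <= \sum_(i <- r | P i) f i.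
Proof.
move=> le_f; apply: (big_ind2 (fun u v => Normc.normc u <= v)) => //.
- by rewrite Normc.normc0.
- by move=> u1 v1 u2 v2 h1 h2; apply: le_trans (le_normcD _ _) (lerD h1 h2).
Qed.

(** A truncation at total degree N may be summed over any larger square of
    indices, so that two truncations can be compared term by term. *)
Lemma total_degree_widen (V : nmodType) (F : nat -> nat -> V) N M : (N < M)%N ->
  \sum_(j < N.+1) \sum_(k < N.+1 | (2 <= j + k <= N)%N) F j k =
  \sum_(j < M) \sum_(k < M | (2 <= j + k <= N)%N) F j k.
Proof.
move=> lt_NM.
rewrite (big_ord_widen M
  (fun j => \sum_(k < N.+1 | (2 <= j + k <= N)%N) F j k)) //.
rewrite big_mkcond; apply: eq_bigr => j _.
rewrite (big_ord_widen_cond M (fun k => (2 <= j + k <= N)%N) (F j)) //.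
case: ifP => [_|/negbT]; last first.
  rewrite -leqNgt => lt_Nj; rewrite big1 // => k /andP[_ le_jkN].
  by have := leq_trans lt_Nj (leq_trans (leq_addr k j) le_jkN); rewrite ltnn.
apply: eq_bigl => k; rewrite andb_idr // => /andP[_ le_jkN].
by rewrite ltnS (leq_trans _ le_jkN) ?leq_addl.
Qed.

(** The error of the truncation at degree N consists of finitely many monomials
    of degree greater than N, each of them O(|z|^(N+1)) on the unit disc. *)
Lemma taylor_coefficients_poly (R : realType) (G : R[i] -> R[i]) (omega : R)
    (g : nat -> nat -> R[i]) (d : nat) :
  (forall z, G z = (0 +i* omega) * z +
    \sum_(j < d.+1) \sum_(k < d.+1 | (2 <= j + k <= d)%N)
      g j k / (j`! * k`!)%:R * z ^+ j * z^* ^+ k) ->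
  (forall j k, (d < j + k)%N -> g j k = 0) ->
  taylor_coefficients G omega g.
Proof.
move=> G_poly g_high N; pose M := (maxn N d).+1.
pose a j k := g j k / (j`! * k`!)%:R.
pose F z j k := a j k * z ^+ j * z^* ^+ k.
pose C := \sum_(j < M) \sum_(k < M) Normc.normc (a j k).
(* On the unit disc, |z|^(j + k) <= |z|^(N + 1) for every term left over. *)
exists C, 1; split=> // z z_lt1.
rewrite G_poly [(0 +i* omega) * z + _]addrC addrK.
rewrite (total_degree_widen (F z) (M := M)) ?ltnS ?leq_maxr //.
rewrite (total_degree_widen (F z) (M := M)) ?ltnS ?leq_maxl //.
rewrite -sumrB mulr_suml; apply: normc_sum_le => j _.
rewrite big_mkcond [X in _ - X]big_mkcond -sumrB mulr_suml.
apply: normc_sum_le => k _.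
have rhs_ge0 : 0 <= Normc.normc (a j k) * Normc.normc z ^+ N.+1.
  by rewrite mulr_ge0 ?exprn_ge0 ?normc_ge0.
have [jk_leN|N_ltjk] := leqP (j + k) N.
  suff -> : (if (2 <= j + k <= d)%N then F z j k else 0) =
      if (2 <= j + k <= N)%N then F z j k else 0.
    by rewrite jk_leN subrr Normc.normc0.
  rewrite jk_leN; case: leqP => //= _; case: leqP => // d_ltjk.
  by rewrite /F /a g_high // !mul0r.
rewrite andbF subr0; case: ifP => _; last first.
  by rewrite Normc.normc0.
rewrite /F -mulrA Normc.normcM (Normc.normcM (z ^+ j)) !normcX.
rewrite normc_conjc -exprD.
apply: ler_wpM2l; first exact: normc_ge0.
by apply: ler_wiXn2l; rewrite ?normc_ge0 ?ltW.
Qed.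

(** * The system in the eigenvector coordinate *)

(** As q1 is a multiple of q0, the state depends on z only through z q0. *)
Lemma real_state_jac2 (R : realType) (omega : R) (q : 'rV[R[i]]_2) (z : R[i]) :
  q 0 1 = - (1 + (0 +i* omega)) * q 0 0 ->
  let w := z * q 0 0 in
  real_state q z =
  vec2 (2 * complex.Re w) (2 * (omega * complex.Im w - complex.Re w)).
Proof.
move=> q1; apply: rV2P; rewrite !mxE /= ?q1;
  case: z (q 0 0) => [zr zi] [u v] /=; ring.
Qed.

(** [b] is the coefficient of the quadratic term: in the variable y the
    nonlinearity is b y^2 - y^3.  The factor i / (2 omega q0) turns a real
    number N into the coordinate of the real state (0, N). *)
Definition complexified_field (R : realType) (omega b : R) (q : 'rV[R[i]]_2)
    (z : R[i]) :=
  let y := z * q 0 1 + (z * q 0 1)^* in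
  (0 +i* omega) * z + 'i%C / (2 * omega%:C * q 0 0) * (b%:C * y ^+ 2 - y ^+ 3).

(** By the chain rule, as y is linear in z and its conjugate; the list contains
    the derivatives of b y^2 - y^3 at 0. *)
Definition complexified_jet (R : realType) (omega b : R) (q : 'rV[R[i]]_2)
    (j k : nat) :=
  'i%C / (2 * omega%:C * q 0 0) * [:: 0; 0; 2 * b%:C; - 6]`_(j + k)
  * q 0 1 ^+ j * (q 0 1)^* ^+ k.

Lemma taylor_complexified_field (R : realType) (omega b : R) (q : 'rV[R[i]]_2) :
  taylor_coefficients (complexified_field omega b q) omega
    (complexified_jet omega b q).
Proof.
apply: (@taylor_coefficients_poly _ _ _ _ 3) => [z|j k d_lt]; last first.
  by rewrite /complexified_jet nth_default // mulr0 !mul0r.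
rewrite /complexified_field /complexified_jet rmorphM.
set c := _ / _.
congr (_ + _).
under eq_bigr do rewrite big_mkcond.
rewrite !big_ord_recl !big_ord0 /=.
rewrite /bump /= !addn0.
rewrite -[(1 + (1 + 1))%N]/3%N -[(1 + 1)%N]/2%N.
rewrite -[0`!]/1%N -[1`!]/1%N -[2`!]/2%N -[3`!]/6%N !muln1 ?mul1n.
by field.
Qed.

(** Multiplying by q0 makes the equation independent of the eigenvector; in the
    coordinate w = z q0 it splits into real and imaginary parts that are
    polynomial in those of w. *)
Lemma complex_form_complexified_field (R : realType) (p s r x omega : R)
    (q : 'rV[R[i]]_2) :
  planar_field p s r (vec2 x (- x)) = 0 ->
  r + 2 * s * x - 3 * x ^+ 2 = 1 -> omega ^+ 2 = p - 1 -> omega != 0 ->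
  q 0 0 != 0 -> q 0 1 = - (1 + (0 +i* omega)) * q 0 0 ->
  complex_form (planar_field p s r) (vec2 x (- x)) q
    (complexified_field omega (3 * x - s) q).
Proof.
move=> f0 tr0 omega2 omega_neq0 q0 q1 z.
rewrite (planar_field_translate _ f0) tr0 !(real_state_jac2 _ q1) vec2_0 vec2_1.
set w := z * q 0 0; set b := 3 * x - s.
set Y := 2 * (omega * complex.Im w - complex.Re w).
have -> : complexified_field omega b q z * q 0 0 =
    (- omega * complex.Im w) +i*
    (omega * complex.Re w + (b * Y ^+ 2 - Y ^+ 3) / (2 * omega)).
  rewrite /complexified_field.
  have -> : z * q 0 1 + (z * q 0 1)^* = Y%:C.
    rewrite q1 mulrCA -/w /Y; case: (w) => u v.
    by apply/eqP; rewrite eq_complex /=; apply/andP; split; apply/eqP; ring.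
  have -> : b%:C * Y%:C ^+ 2 - Y%:C ^+ 3 = (b * Y ^+ 2 - Y ^+ 3)%:C.
    by ring.
  have omegaC_neq0 : omega%:C != 0 by rewrite fmorph_eq0.
  have c_q0 : 'i%C / (2 * omega%:C * q 0 0) * q 0 0 =
      'i%C * ((2 * omega)^-1)%:C.
    by rewrite fmorphV rmorphM rmorph_nat; field; apply/andP; split=> //.
  rewrite mulrDl -mulrA -/w mulrAC c_q0 -/Y; case: (w) => u v.
  by apply/eqP; rewrite eq_complex /=; apply/andP; split; apply/eqP; ring.
congr vec2; rewrite /= -/Y.
  by rewrite /Y; ring.
have -> : p = 1 + omega ^+ 2 by rewrite omega2; ring.
by rewrite /Y; field.
Qed.

(** The expression factors as |q1|^2 times a polynomial in c q1, and c q1 does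
    not depend on the eigenvector: hence neither does the sign. *)
Lemma lyapunov1_complexified_jet (R : realType) (omega b : R)
    (q : 'rV[R[i]]_2) :
  omega != 0 -> q 0 0 != 0 -> q 0 1 = - (1 + (0 +i* omega)) * q 0 0 ->
  lyapunov1 omega (complexified_jet omega b q) =
  (2 * omega ^+ 2)^-1 *
  (Normc.normc (q 0 1) ^+ 2 * (2 * b ^+ 2 - 3 * omega ^+ 2) / omega).
Proof.
move=> omega_neq0 q0 q1; congr (_ * _); rewrite /complexified_jet.
set c := 'i%C / _.
have c_q1 : c * q 0 1 = 2^-1 -i* (2 * omega)^-1.
  have omegaC_neq0 : omega%:C != 0 by rewrite fmorph_eq0.
  have -> : c * q 0 1 = 'i%C * - (1 + (0 +i* omega)) * ((2 * omega)^-1)%:C.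
    by rewrite q1 /c fmorphV rmorphM rmorph_nat; field; apply/andP; split=> //.
  by apply/eqP; rewrite eq_complex /=; apply/andP; split; apply/eqP; field.
have n_q1 : q 0 1 * (q 0 1)^* = (Normc.normc (q 0 1) ^+ 2)%:C.
  case: (q 0 1) => u v; rewrite /= sqr_sqrtr ?addr_ge0 ?sqr_ge0 //.
  by apply/eqP; rewrite eq_complex /=; apply/andP; split; apply/eqP; ring.
set n := _ ^+ 2 in n_q1 *.
transitivity (complex.Re (n%:C * ((4 * b ^+ 2)%:C * ('i%C * (c * q 0 1) ^+ 2)
                          - (6 * omega)%:C * (c * q 0 1)))).
  by congr complex.Re; rewrite -n_q1 /=; ring.
rewrite c_q1 !expr2 /=.
by field.
Qed.

(** * The critical parameter value *)

(** The critical value makes the discriminant a perfect square, which removes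
    the nested square root from x1*. *)
Lemma critical_values (R : realType) (p r s : R) :
  0 <= s -> 1 < p ->
  r = 8^-1 * (- 4 + 12 * p - s ^+ 2 - s * Num.sqrt (- 8 + 8 * p + s ^+ 2)) ->
  let w := Num.sqrt (- 8 + 8 * p + s ^+ 2) in
  [/\ s < w, p = 1 + (w ^+ 2 - s ^+ 2) / 8,
   s ^+ 2 + 4 * (r - p) = ((w - s) / 2) ^+ 2 & x1star p s r = (s + w) / 4].
Proof.
move=> s_ge0 p_gt1 + w; rewrite -/w => r_crit.
have w2 : w ^+ 2 = - 8 + 8 * p + s ^+ 2.
  by rewrite sqr_sqrtr //; have := sqr_ge0 s; lra.
have p_w : p = 1 + (w ^+ 2 - s ^+ 2) / 8 by rewrite w2; field.
have lt_sw : s < w.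
  by rewrite -(ltr_pXn2r (n := 2)) ?nnegrE ?sqrtr_ge0 //; lra.
have disc : s ^+ 2 + 4 * (r - p) = ((w - s) / 2) ^+ 2.
  by rewrite r_crit p_w; field.
split=> //; rewrite /x1star disc sqrtr_sqr ger0_norm; first by field.
by lra.
Qed.

Theorem proposition7 (R : realType) (p r s : R) (hp : 0 < p) (hr : 0 < r)
    (hs : 0 <= s) (hp1 : 1 < p)
    (hr0 : r = 8^-1 * (- 4 + 12 * p - s ^+ 2
                       - s * Num.sqrt (- 8 + 8 * p + s ^+ 2))) :
  subcritical_hopf_bifurcation (planar_field p s) (P1 p s) r.
Proof.
have [] := critical_values hs hp1 hr0; move: hr0.
set w := Num.sqrt _ => r_crit lt_sw p_w disc x_w.
have disc_gt0 : 0 < s ^+ 2 + 4 * (r - p).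
  by rewrite disc exprn_gt0 // divr_gt0 // subr_gt0.
have tr0 : P1_trace p s r = 0.
  by rewrite /P1_trace x_w r_crit p_w; field.
set omega := Num.sqrt (p - 1).
have omega_gt0 : 0 < omega by rewrite sqrtr_gt0 subr_gt0.
have omega_neq0 : omega != 0 by rewrite gt_eqF.
have omega2 : omega ^+ 2 = p - 1 by rewrite sqr_sqrtr // subr_ge0 ltW.
exists omega; split; first exact: hopf_bifurcation_P1.
move=> q q_neq0; rewrite (complex_jacobian_P1 (ltW disc_gt0)) tr0 addr0.
move=> /eigenvector_jac2 /(_ q_neq0) [q0 q1].
set x := x1star p s r in x_w.
exists (complexified_field omega (3 * x - s) q),
  (complexified_jet omega (3 * x - s) q); split.
- apply: (complex_form_complexified_field (planar_field_P1 (ltW disc_gt0))) => //.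
  by rewrite -/x x_w r_crit p_w; field.
- exact: taylor_complexified_field.
- rewrite lyapunov1_complexified_jet //.
  have norm_gt0 : 0 < Normc.normc (q 0 1).
    rewrite lt_neqAle normc_ge0 andbT eq_sym; apply/eqP => /Normc.eq0_normc/eqP.
    rewrite q1 mulf_eq0 (negPf q0) orbF eq_complex /= addr0 oppr_eq0.
    by rewrite oner_eq0.
  apply: mulr_gt0; first by rewrite invr_gt0 mulr_gt0 // exprn_gt0.
  apply: divr_gt0 => //; apply: mulr_gt0; first exact: exprn_gt0.
  rewrite omega2.
  have -> : 2 * (3 * x - s) ^+ 2 - 3 * (p - 1) =
      (6 * (w * (w - s)) + 4 * s ^+ 2) / 8.
    by rewrite x_w p_w; field.
  rewrite divr_gt0 // ltr_wpDr ?mulr_ge0 ?sqr_ge0 //.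
  by rewrite !mulr_gt0 ?subr_gt0 // (le_lt_trans hs).
Qed.
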